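(* For every $k \in \mathbb{N}$, there exists a tree $T_k$ on $n = 2(3k+1)$ vertices such that $I_s(T_k) \leq \frac{5}{12}n + \frac{13}{6}$.
   Context: The competition-independence game on a graph $G$ is played by two players, Sweller and Diminisher, who alternately choose a vertex of $G$ not adjacent to (and distinct from) any previously chosen vertex, until no such vertex exists; the chosen set is then a maximal independent set of $G$. Sweller wants the final set to be as large as possible, Diminisher as small as possible. $I_s(G)$ denotes the size of the final set (equivalently, the number of moves) when Sweller moves first and both players play optimally. *)

(* Defs.v *)
From mathcomp Require Import all_boot all_order all_algebra.

Set Implicit Arguments.
Unset Strict Implicit.
Unset Printing Implicit Defensive.

Definition simple_graph (T : finType) (e : rel T) : Prop :=
  symmetric e /\ irreflexive e.

Definition connected_graph (T : finType) (e : rel T) : Prop :=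
  0 < #|T| /\ forall x y : T, connect e x y.

(* [ucycle e c] also holds when [c] is a single edge traversed back and forth,
   hence the length condition. *)
Definition acyclic_graph (T : finType) (e : rel T) : Prop :=
  forall c : seq T, 2 < size c -> ~ ucycle e c.

Definition tree (T : finType) (e : rel T) : Prop :=
  [/\ simple_graph e, connected_graph e & acyclic_graph e].

Inductive player := Sweller | Diminisher.

Section CompetitionIndependence.

Variables (T : finType) (e : rel T).

Definition legal_moves (S : {set T}) : {set T} :=
  [set v | (v \notin S) && [forall u in S, ~~ e u v]].

(* The size of the final set under optimal play from the position in which [S]
   has been chosen and [p] is to move. [fuel] bounds the number of remaining
   moves; by [game_valueE] below the bound used in [game_value] never truncates
   the game. The default value [#|T|] of the minimum is
   at least the size of any final set, so it does not affect the minimum. *)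
Fixpoint game_value_rec (fuel : nat) (p : player) (S : {set T}) : nat :=
  if fuel is fuel'.+1 then
    if legal_moves S == set0 then #|S| else
    match p with
    | Sweller =>
        \max_(v in legal_moves S) game_value_rec fuel' Diminisher (v |: S)
    | Diminisher =>
        \big[minn/#|T|]_(v in legal_moves S)
           game_value_rec fuel' Sweller (v |: S)
    end
  else #|S|.

Definition game_value (p : player) (S : {set T}) : nat :=
  game_value_rec #|T| p S.

Definition I_s : nat := game_value Sweller set0.

Lemma card_legal_move (S : {set T}) (v : T) :
  v \in legal_moves S -> #|v |: S| = #|S|.+1.
Proof. by rewrite inE => /andP[vS _]; rewrite cardsU1 vS. Qed.

Lemma game_value_rec_fuel (m n : nat) (p : player) (S : {set T}) :
  #|T| <= m + #|S| -> #|T| <= n + #|S| ->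
  game_value_rec m p S = game_value_rec n p S.
Proof.
have full (S' : {set T}) : #|T| <= #|S'| -> legal_moves S' == set0.
  move=> le; have /eqP -> : S' == setT by rewrite eqEcard subsetT cardsT.
  by apply/eqP/setP => v; rewrite !inE.
elim: m n p S => [|m IH] [|n] p S //= Hm Hn; try by rewrite full.
case: ifP => // _.
have step v q : v \in legal_moves S ->
    game_value_rec m q (v |: S) = game_value_rec n q (v |: S).
  by move=> Lv; apply: IH; rewrite (card_legal_move Lv) addnS -addSn.
by case: p; apply: eq_bigr => v Lv; apply: step.
Qed.

Lemma game_valueE (p : player) (S : {set T}) :
  game_value p S =
    if legal_moves S == set0 then #|S| else
    match p with
    | Sweller => \max_(v in legal_moves S) game_value Diminisher (v |: S)
    | Diminisher =>
        \big[minn/#|T|]_(v in legal_moves S) game_value Sweller (v |: S)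
    end.
Proof.
rewrite /game_value (@game_value_rec_fuel _ #|T|.+1) ?leq_addr //=.
by rewrite addSn leqW ?leq_addr.
Qed.

Lemma game_value_le (p : player) (S : {set T}) : game_value p S <= #|T|.
Proof.
rewrite /game_value; elim: {1}#|T| p S => [|n IH] p S /=; first exact: max_card.
case: ifP => _; first exact: max_card.
case: p; first by apply/bigmax_leqP.
apply: (big_ind (fun m => m <= #|T|)) => // a b Ha _.
exact: leq_trans (geq_minl a b) Ha.
Qed.

Lemma game_value_DiminisherP (S : {set T}) : legal_moves S != set0 ->
  (exists2 v, v \in legal_moves S &
     game_value Diminisher S = game_value Sweller (v |: S)) /\
  (forall v, v \in legal_moves S ->
     game_value Diminisher S <= game_value Sweller (v |: S)).
Proof.
move=> nz; rewrite game_valueE (negPf nz).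
case/set0Pn: nz => v0 Lv0.
pose F v := game_value Sweller (v |: S).
case: (arg_minnP F Lv0) => w Lw minw.
suff -> : \big[minn/#|T|]_(v in legal_moves S) F v = F w by split; [exists w|].
apply/eqP; rewrite eqn_leq; apply/andP; split; last first.
  elim/big_ind: _ => [|a b Ha Hb|v Lv]; [exact: game_value_le| |exact: minw].
  by rewrite leq_min Ha.
rewrite -big_filter.
have: w \in [seq v <- index_enum T | v \in legal_moves S].
  by rewrite mem_filter mem_index_enum andbT.
elim: [seq _ <- _ | _] => // a s IH; rewrite inE big_cons => /orP[/eqP <-|/IH].
  exact: geq_minl.
by apply: leq_trans; apply: geq_minr.
Qed.

End CompetitionIndependence.

(* Main.v *)
Require Import Defs.
From mathcomp Require Import all_boot all_order all_algebra.
From mathcomp Require Import zify lra.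

(** The tree consists of two spiders, each with [k] legs of length 3, whose
    centres are joined by an edge. Once one centre is chosen, the other one is
    blocked and every leg of the first spider receives at most one chosen
    vertex, whereas a leg of the second spider receives at most two, and only
    one as soon as its middle vertex is chosen. Diminisher makes sure that some
    centre is chosen after his first move, and from then on he chooses middle
    vertices of untouched legs of the second spider; Sweller spoils at most one
    such leg per move, so about half of them end up with a single vertex. *)

Set Implicit Arguments.
Unset Strict Implicit.
Unset Printing Implicit Defensive.

(** * Height criteria for trees, and potentials bounding the game value *)

Section GeneralGraphs.

Variables (T : finType) (e : rel T).

(** A highest vertex of a cycle has both its cycle neighbours at most as high as itself. The
    hypothesis makes them equal, which a cycle of length at least 3 without repetition excludes. *)
Lemma acyclic_by_height (h : T -> nat) : symmetric e ->
  (forall x y z, e x y -> e x z -> h y <= h x -> h z <= h x -> y = z) ->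
  acyclic_graph e.
Proof.
move=> sym_e uniq_low c c_gt2 /andP[cyc_c uniq_c].
have [x0 x0c] : exists x, x \in c.
  by case: c c_gt2 {cyc_c uniq_c} => // a s; exists a; rewrite mem_head.
have [x xc max_x] := arg_maxnP h x0c.
have {xc} [i s rot_c] := rot_to xc.
have mem_s y : y \in s -> h y <= h x.
  move=> ys; have yc : y \in c by rewrite -(mem_rot i) rot_c inE ys orbT.
  exact: max_x yc.
move: c_gt2 cyc_c uniq_c.
rewrite -(size_rot i) -(rot_cycle i) -(rot_uniq i) rot_c /= ltnS.
case: s mem_s {rot_c} => // y s mem_s; case/lastP: s mem_s => // s z mem_s _.
rewrite /= rcons_path last_rcons => /and3P[exy _ ezx] /and3P[_ y_notin _].
have y_z : y = z.
  apply: (uniq_low x); rewrite // 1?sym_e //; apply: mem_s.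
    exact: mem_head.
  by rewrite inE mem_rcons mem_head orbT.
by move: y_notin; rewrite y_z mem_rcons mem_head.
Qed.

Lemma connected_by_height (h : T -> nat) (r : T) : symmetric e ->
  (forall x, x != r -> exists2 y, e x y & h y < h x) ->
  connected_graph e.
Proof.
move=> sym_e down; split; first by apply/card_gt0P; exists r.
have to_r x : connect e x r.
  elim: {x}(h x) {-2}x (leqnn (h x)) => [|n IH] x le_x.
    have [->//|/down[y _]] := eqVneq x r; lia.
  have [->//|/down[y exy lt_y]] := eqVneq x r.
  by apply: connect_trans (connect1 exy) (IH y _); lia.
move=> x y; apply: connect_trans (to_r x) _.
by rewrite (sym_connect_sym sym_e).
Qed.

Definition independent (S : {set T}) := [forall u in S, forall v in S, ~~ e u v].

Lemma independentP (S : {set T}) :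
  reflect {in S &, forall u v, ~~ e u v} (independent S).
Proof.
apply: (iffP forall_inP) => [ind u v uS vS | ind u uS].
  exact: (forall_inP (ind u uS)).
by apply/forall_inP => v vS; apply: ind.
Qed.

Lemma independent_legal (S : {set T}) v : simple_graph e ->
  independent S -> v \in legal_moves e S -> independent (v |: S).
Proof.
case=> sym_e irr_e /independentP ind; rewrite inE => /andP[_ /forall_inP leg].
apply/independentP => u w /setU1P[->|uS] /setU1P[->|wS]; rewrite ?irr_e //.
- by rewrite sym_e leg.
- exact: leg.
- exact: ind.
Qed.

(** [pot] certifies a strategy of Diminisher: no move of Sweller raises it, some move of Diminisher
    does not raise it, and at the end it bounds the size of the chosen set. The induction is on the
    number of unchosen vertices. *)
Lemma game_value_le_potential
    (inv : pred {set T}) (pot : player -> {set T} -> nat) :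
  (forall p S, inv S -> legal_moves e S = set0 -> #|S| <= pot p S) ->
  (forall S v, inv S -> v \in legal_moves e S ->
     inv (v |: S) /\ pot Diminisher (v |: S) <= pot Sweller S) ->
  (forall S, inv S -> legal_moves e S != set0 ->
     exists2 v, v \in legal_moves e S &
       inv (v |: S) /\ pot Sweller (v |: S) <= pot Diminisher S) ->
  forall p S, inv S -> game_value e p S <= pot p S.
Proof.
move=> final swell dimin p S.
elim: {S}(#|T| - #|S|) {-2}S p (leqnn (#|T| - #|S|)) => [|n IH] S p le_n invS.
  have [L0|/set0Pn[v Lv]] := eqVneq (legal_moves e S) set0.
    by rewrite game_valueE L0 eqxx final.
  have : #|v |: S| <= #|T| by exact: max_card.
  by rewrite (card_legal_move Lv); lia.
have [L0|nz] := eqVneq (legal_moves e S) set0.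
  by rewrite game_valueE L0 eqxx final.
have smaller v : v \in legal_moves e S -> #|T| - #|v |: S| <= n.
  by move=> Lv; have := card_legal_move Lv; lia.
case: p.
  rewrite game_valueE (negPf nz); apply/bigmax_leqP => v Lv.
  have [invvS le_pot] := swell _ _ invS Lv.
  by apply: leq_trans le_pot; apply: IH; rewrite ?smaller.
have [v Lv [invvS le_pot]] := dimin _ invS nz.
have [_ /(_ v Lv) le_v] := game_value_DiminisherP nz.
by apply: leq_trans le_v (leq_trans (IH _ _ _ _) le_pot); rewrite ?smaller.
Qed.

End GeneralGraphs.

(** * The double spider is a tree of the required order *)

Section DoubleSpider.

Variable k : nat.

(* [inl t] is the centre of spider [t]; [inr (t, j, i)] is the vertex of leg
   [j] of spider [t] at distance [i + 1] from the centre. *)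
Definition spider_vertex : finType := (bool + bool * 'I_k * 'I_3)%type.

Implicit Types (s t : bool) (j : 'I_k) (S : {set spider_vertex}).

Definition centre t : spider_vertex := inl t.
Definition leg t j (i : 'I_3) : spider_vertex := inr (t, j, i).

Definition spider_edge : rel spider_vertex := fun x y =>
  match x, y with
  | inl t, inl t' => t != t'
  | inl t, inr (t', _, i) | inr (t', _, i), inl t => (t == t') && (i == 0 :> nat)
  | inr (t, j, i), inr (t', j', i') =>
      [&& t == t', j == j' & (i == i'.+1 :> nat) || (i' == i.+1 :> nat)]
  end.

Lemma spider_edge_simple : simple_graph spider_edge.
Proof.
split=> [[t|[[t j] i]] [t'|[[t' j'] i']]|[t|[[t j] i]]] //=.
- by rewrite eq_sym.
- by rewrite [t == _]eq_sym [j == _]eq_sym orbC.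
- by rewrite eqxx.
- by rewrite !eqxx /=; lia.
Qed.

(** The tree is rooted at [centre true]. Heights are distances to the root, except that the legs of
    spider [true] are raised by one so that both spiders share a formula. *)
Definition spider_height (x : spider_vertex) : nat :=
  match x with inl t => ~~ t | inr (_, _, i) => i.+2 end.

Lemma spider_tree : tree spider_edge.
Proof.
have [sym_e irr_e] := spider_edge_simple.
split; first exact: spider_edge_simple.
  apply: (@connected_by_height _ _ spider_height (centre true)) => //.
  case=> [[]|[[t j] [[|i] lt_i]]] // _.
  - by exists (centre true).
  - by exists (centre t); [rewrite /= !eqxx | case: t].
  - exists (leg t j (Ordinal (ltnW lt_i))) => //=.
    by rewrite !eqxx.
apply: (@acyclic_by_height _ _ spider_height) => //.
case=> [t|[[t j] i]] [t'|[[t' j'] i']] [t''|[[t'' j''] i'']] //=.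
- by case: t t' t'' => [] [] [].
- by case: t; lia.
- by case: t; lia.
- by case: t; lia.
- by move=> /andP[/eqP-> _] /andP[/eqP-> _].
- by move=> /andP[_ /eqP i0] /and3P[_ _]; lia.
- by move=> /and3P[_ _ ii'] /andP[_ /eqP i0]; lia.
move=> /and3P[/eqP<- /eqP<- ii'] /and3P[/eqP<- /eqP<- ii''] le' le''.
by congr (inr (_, _, _)); apply: val_inj => /=; lia.
Qed.

Lemma card_spider_vertex : #|spider_vertex| = 2 * (3 * k + 1).
Proof. rewrite card_sum !card_prod card_bool !card_ord; lia. Qed.

(** * How a move affects chosen middle vertices and untouched legs *)

Definition mid : 'I_3 := Ordinal (isT : 1 < 3).

Definition middles t S := [set j | leg t j mid \in S].
Definition untouched t S := [set j | [forall i, leg t j i \notin S]].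

Lemma middlesS t S v : #|middles t S| <= #|middles t (v |: S)|.
Proof.
by apply/subset_leq_card/subsetP => j; rewrite !inE => ->; rewrite orbT.
Qed.

Lemma middles_leg t S j : j \in untouched t S ->
  #|middles t S| < #|middles t (leg t j mid |: S)|.
Proof.
rewrite inE => /forallP/(_ mid) jS; apply/proper_card/properP; split.
  by apply/subsetP => j'; rewrite !inE => ->; rewrite orbT.
by exists j; rewrite inE ?setU11.
Qed.

Lemma untouchedS t S v : #|untouched t S| <= #|untouched t (v |: S)|.+1.
Proof.
case: v => [t'|[[t' j] i]].
  apply/leqW/subset_leq_card/subsetP => j; rewrite !inE => /forallP free.
  by apply/forallP => i; rewrite !inE negb_or free.
rewrite -add1n.
apply: (@leq_trans #|j |: untouched t (leg t' j i |: S)|).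
  apply/subset_leq_card/subsetP => j'; rewrite !inE => /forallP free.
  have [//|neq_j] := eqVneq j' j; apply/forallP => i'.
  rewrite !inE negb_or free andbT; apply/eqP; case=> _ eq_j _.
  by rewrite eq_j eqxx in neq_j.
by rewrite cardsU1 leq_add2r leq_b1.
Qed.

(** All neighbours of a middle vertex lie on its own leg. *)
Lemma untouched_legal t S j : centre t \notin S -> j \in untouched t S ->
  leg t j mid \in legal_moves spider_edge S.
Proof.
move=> ctS; rewrite !inE => /forallP free; rewrite free /=.
apply/forall_inP => -[t'|[[t' j'] i]] uS /=; first by rewrite andbF.
apply/and3P => -[/eqP eq_t /eqP eq_j _].
by have := free i; rewrite -eq_t -eq_j /leg uS.
Qed.

(** * Size of independent sets, leg by leg *)

Lemma card_spider_set S :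
  #|S| = \sum_t ((centre t \in S) + \sum_j \sum_i (leg t j i \in S)).
Proof.
rewrite -sum1_card big_mkcond big_sumType /= big_split /=; congr (_ + _).
under [RHS]eq_bigr do rewrite pair_big /=.
rewrite pair_big /=.
rewrite (reindex (fun p : bool * ('I_k * 'I_3) => (p.1, p.2.1, p.2.2))) /=.
  by apply: eq_bigr => -[t [j i]] _ /=; rewrite /leg; case: ifP.
by exists (fun p => (p.1.1, (p.1.2, p.2))) => [[t [j i]]|[[t j] i]].
Qed.

(** A chosen middle vertex excludes both ends of its leg, so counting it twice still gives at most
    2. Each chosen middle thus saves one vertex. *)
Lemma independent_leg S t j : independent spider_edge S ->
  \sum_i (leg t j i \in S) + (leg t j mid \in S) <= 2.
Proof.
move=> /independentP ind; rewrite !big_ord_recl big_ord0.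
set a := leg t j ord0; set b := leg t j _; set d := leg t j _.
have -> : leg t j mid = b by congr leg; apply: val_inj.
have Hab : ~~ ((a \in S) && (b \in S)).
  by apply/negP => /andP[aS bS]; have := ind a b aS bS; rewrite /= !eqxx.
have Hbd : ~~ ((b \in S) && (d \in S)).
  by apply/negP => /andP[bS dS]; have := ind b d bS dS; rewrite /= !eqxx.
by move: Hab Hbd; do 3!case: (_ \in S).
Qed.

Lemma independent_centre_leg S t j : independent spider_edge S ->
  centre t \in S -> \sum_i (leg t j i \in S) <= 1.
Proof.
move=> /independentP ind ctS; rewrite !big_ord_recl big_ord0.
set a := leg t j ord0; set b := leg t j _; set d := leg t j _.
have -> : a \in S = false.
  by apply/negP => aS; have := ind _ _ ctS aS; rewrite /= !eqxx.
have : ~~ ((b \in S) && (d \in S)).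
  by apply/negP => /andP[bS dS]; have := ind b d bS dS; rewrite /= !eqxx.
by do 2!case: (_ \in S).
Qed.

Lemma independent_centre S s : independent spider_edge S ->
  centre s \in S -> centre (~~ s) \notin S.
Proof.
move=> /independentP ind csS; apply/negP => csS'.
by have := ind _ _ csS csS'; case: s {csS csS'}.
Qed.

(** The bound splits as 1 for the centre, [k] for the legs of spider [s], and [2 * k] less the
    chosen middles for the other spider, whose centre is blocked. *)
Lemma independent_card S s : independent spider_edge S -> centre s \in S ->
  #|S| + #|middles (~~ s) S| <= 1 + 3 * k.
Proof.
move=> indS csS.
have legs_s : \sum_j \sum_i (leg s j i \in S) <= k.
  apply: (@leq_trans (\sum_(j < k) 1)); last by rewrite sum1_card card_ord.
  by apply: leq_sum => j _; apply: independent_centre_leg.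
have legs_ns :
    \sum_j \sum_i (leg (~~ s) j i \in S) + #|middles (~~ s) S| <= 2 * k.
  have -> : #|middles (~~ s) S| = \sum_j (leg (~~ s) j mid \in S).
    rewrite -sum1_card big_mkcond /=; apply: eq_bigr => j _.
    by rewrite inE; case: ifP.
  rewrite -big_split /=; apply: (@leq_trans (\sum_(j < k) 2)); last first.
    by rewrite sum_nat_const card_ord mulnC.
  by apply: leq_sum => j _; apply: independent_leg.
have := negPf (independent_centre indS csS).
rewrite card_spider_set big_bool.
by case: s csS legs_s legs_ns => /= ->; lia.
Qed.

(** * The potential once a centre is chosen *)

Definition spider_inv s S := independent spider_edge S && (centre s \in S).

(** The bound of [independent_card], lowered also by the middles that Diminisher can still secure:
    half of the untouched legs, rounded up if he is to move and down otherwise. *)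
Definition spider_pot s (p : player) S : nat :=
  1 + 3 * k - (#|middles (~~ s) S| +
    (#|untouched (~~ s) S| + (if p is Diminisher then 1 else 0)) %/ 2).

Lemma spider_inv_legal s S v : spider_inv s S ->
  v \in legal_moves spider_edge S -> spider_inv s (v |: S).
Proof.
move=> /andP[indS csS] Lv; apply/andP; split; last exact: setU1r.
exact: independent_legal spider_edge_simple indS Lv.
Qed.

Lemma spider_value s p S : spider_inv s S ->
  game_value spider_edge p S <= spider_pot s p S.
Proof.
move: p S; apply: game_value_le_potential
  => [p S /andP[indS csS] L0|S v invS Lv|S invS nz].
- have := independent_card indS csS; rewrite /spider_pot.
  have /eqP : untouched (~~ s) S == set0.
    apply/eqP/setP => j; rewrite in_set0; apply/negP => free.
    have := untouched_legal (independent_centre indS csS) free.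
    by rewrite L0 inE.
  by move=> ->; rewrite cards0; case: p; lia.
- split; first exact: spider_inv_legal.
  rewrite /spider_pot.
  (* Sweller spoils at most one untouched leg, and the rounding up on Diminisher's turn makes up for
     it. *)
  by have := middlesS (~~ s) S v; have := untouchedS (~~ s) S v; lia.
have /andP[indS csS] := invS.
(* Without untouched legs the halved term is already 0, so any legal move will do; otherwise
   Diminisher takes the middle of an untouched leg. *)
have [U0|/set0Pn[j free]] := eqVneq (untouched (~~ s) S) set0.
  case/set0Pn: nz => v Lv; exists v => //; split; first exact: spider_inv_legal.
  by rewrite /spider_pot U0 cards0; have := middlesS (~~ s) S v; lia.
have Lv := untouched_legal (independent_centre indS csS) free.
exists (leg (~~ s) j mid) => //; split; first exact: spider_inv_legal.
rewrite /spider_pot.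
have := middles_leg free; have := untouchedS (~~ s) S (leg (~~ s) j mid); lia.
Qed.

Lemma untouched0 t : #|untouched t set0| = k.
Proof.
rewrite -[RHS]card_ord -cardsT; apply: eq_card => j; rewrite !inE.
by apply/forallP => i; rewrite inE.
Qed.

Lemma I_s_spider : 2 * I_s spider_edge <= 5 * k + 4.
Proof.
(* At least [k - 1] untouched legs secure at least [(k - 2) / 2] further middles even with Sweller
   to move, and [1 + 3k - (k - 2) / 2] is [(5k + 4) / 2]. *)
have le_pot s p S : spider_inv s S -> k <= #|untouched (~~ s) S|.+1 ->
    2 * game_value spider_edge p S <= 5 * k + 4.
  by move=> /(spider_value p); rewrite /spider_pot; case: p; lia.
have indep0 : independent spider_edge set0.
  by apply/independentP => u v; rewrite inE.
have legal0 v : v \in legal_moves spider_edge set0.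
  by rewrite !inE; apply/forall_inP => u; rewrite inE.
suff step v : 2 * game_value spider_edge Diminisher (v |: set0) <= 5 * k + 4.
  suff : I_s spider_edge <= (5 * k + 4) %/ 2 by lia.
  rewrite /I_s game_valueE; case: ifP => _; first by rewrite cards0.
  by apply/bigmax_leqP => v _; have := step v; lia.
have indepv := independent_legal spider_edge_simple indep0 (legal0 v).
have free t : k <= #|untouched t (v |: set0)|.+1.
  by rewrite -[X in X <= _](untouched0 t) untouchedS.
case: v indepv free => [s|[[t j] i]] indepv free.
  by apply: (le_pot s); rewrite ?free // /spider_inv indepv setU11.
(* If Sweller opens on a leg of spider [t], Diminisher answers with the opposite centre, legal
   wherever on the leg she played. Spider [t] then has the unchosen centre and has lost only one
   untouched leg. *)
have Lc : centre (~~ t) \in legal_moves spider_edge (leg t j i |: set0).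
  rewrite !inE /=; apply/forall_inP => u; rewrite !inE orbF => /eqP->.
  by rewrite /=; case: (t).
have nz : legal_moves spider_edge (leg t j i |: set0) != set0.
  by apply/set0Pn; exists (centre (~~ t)).
have [_ /(_ _ Lc) le_c] := game_value_DiminisherP nz.
apply: leq_trans (leq_mul (leqnn 2) le_c) _; apply: (le_pot (~~ t)).
  by rewrite /spider_inv setU11 (independent_legal spider_edge_simple).
rewrite negbK; apply: leq_trans (free t) _; rewrite ltnS.
apply/subset_leq_card/subsetP => j'; rewrite !inE => /forallP free_j'.
by apply/forallP => i'; rewrite in_setU1 negb_or free_j'.
Qed.

End DoubleSpider.

Theorem theorem3 (k : nat) :
  exists (T : finType) (e : rel T),
    [/\ tree e,
        #|T| = (2 * (3 * k + 1))%N
      & ((I_s e)%:R <= 5%:R / 12%:R * #|T|%:R + 13%:R / 6%:R :> rat)%R].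
Proof.
exists (spider_vertex k), (@spider_edge k).
split; [exact: spider_tree | exact: card_spider_vertex |].
(* For [n = 6k + 2] the claimed bound equals [5k/2 + 3], one more than the [5k/2 + 2] obtained
   here. *)
rewrite card_spider_vertex; have := I_s_spider k.
rewrite -(Num.Theory.ler_nat rat) !(GRing.natrD, GRing.natrM); lra.
Qed.
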